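(* Let $(Y_n)_{n\ge1}$ be i.i.d. Gaussian with positive variance. Let $\rho\in(0,1)$ and let $(\alpha_n)_{n\ge0}$ be a sequence of positive numbers such that $\alpha_{n+m}\le C\alpha_n\alpha_m$ for all $n,m\ge0$ (for some constant $C$) and $\lim_{n\to\infty}e^{-\lambda n}\alpha_n=0$ for every $\lambda>0$. Let $X_n:=\sum_{k=1}^n\alpha_{n-k}\rho^{n-k}Y_k$. Then for every $x\in\mathbb{R}$, $$\liminf_{N\to\infty}-N^{-1}\log\mathbb{P}\Big(\sup_{n=1,\dots,N}X_n\le x\Big)>0 .$$ *)

(* Defs.v *)
From HB Require Import structures.
From mathcomp Require Import all_boot all_order all_algebra.
From mathcomp Require Import all_classical all_reals all_analysis.
From mathcomp Require Import normal_distribution.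
Set Implicit Arguments. Unset Strict Implicit. Unset Printing Implicit Defensive.
Import Order.TTheory GRing.Theory Num.Theory.
Local Open Scope classical_set_scope.
Local Open Scope ring_scope.

Definition mutually_independent_from1 d (T : measurableType d) (R : realType)
    (P : probability T R) (Y : nat -> {RV P >-> R}) : Prop :=
  forall (s : seq nat) (B : nat -> set R),
    uniq s -> all (fun k => (0 < k)%N) s -> (forall k, measurable (B k)) ->
    P (\big[setI/setT]_(k <- s) (Y k @^-1` B k)) =
    (\prod_(k <- s) P (Y k @^-1` B k))%E.

(* X has the Gaussian law N(m, s^2) (s is the standard deviation). *)
Definition gaussian_rv d (T : measurableType d) (R : realType)
    (P : probability T R) (X : {RV P >-> R}) (m s : R) : Prop :=
  forall A : set R, measurable A -> distribution P X A = normal_prob m s A.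

Definition Xproc d (T : measurableType d) (R : realType)
    (P : probability T R) (Y : nat -> {RV P >-> R}) (alpha : nat -> R) (rho : R)
    (n : nat) (w : T) : R :=
  \sum_(1 <= k < n.+1) alpha (n - k)%N * rho ^+ (n - k) * Y k w.

Definition sup_le_event d (T : measurableType d) (R : realType)
    (P : probability T R) (Y : nat -> {RV P >-> R}) (alpha : nat -> R) (rho : R)
    (N : nat) (x : R) : set T :=
  [set w | forall n : nat, (1 <= n <= N)%N -> Xproc Y alpha rho n w <= x].

(* Main.v *)
(** The weights satisfy [alpha j * rho ^+ j <= K * r ^+ j] for some [r < 1], so
    [X_(n+1) >= alpha 0 * Y_(n+1) - Z_n], where [Z_0 = 0] and
    [Z_(n+1) = r * (Z_n + K * |Y_(n+1)|)] is a Markov chain.  If the process stays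
    below [x], then [alpha 0 * Y_(n+1) <= x + Z_n] at every step.  On that event
    [1 + eps * Z_n] is a Lyapunov function: for large [Z_n] it contracts on average
    since [r < 1] and [E|Y|] is finite; for bounded [Z_n] survival forces [Y_(n+1)]
    below a fixed level, which has probability less than one.  Independence of
    [Y_(n+1)] from the past makes the expectation decay like [q ^+ n] with [q < 1],
    and [1 + eps * Z_n >= 1] bounds the survival probability.  Since [ln 0 = 0] in
    the library, positivity of that probability is needed as well; it holds because
    all [Y_k] may be very negative. *)

Require Import Defs.
From HB Require Import structures.
From mathcomp Require Import all_boot all_order all_algebra.
From mathcomp Require Import all_classical all_reals all_analysis.
From mathcomp Require Import measurable_realfun normal_distribution.
From mathcomp Require Import ring lra.

Set Implicit Arguments. Unset Strict Implicit. Unset Printing Implicit Defensive.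
Import Order.TTheory GRing.Theory Num.Theory.
Local Open Scope classical_set_scope.
Local Open Scope ring_scope.

(** * Independence of the past *)

Section Independence.
Context d (T : measurableType d) (R : realType) (P : probability T R).
Local Open Scope ereal_scope.

Lemma integral_indep_event (D : set T) (U : T -> R) : measurable D ->
  measurable_fun setT U -> (forall w, 0 <= U w)%R ->
  (forall A, measurable A -> P (U @^-1` A `&` D) = P (U @^-1` A) * P D) ->
  \int[P]_(w in D) (U w)%:E = P D * \int[P]_w (U w)%:E.
Proof.
move=> mD mU U0 indep.
have mEU : measurable_fun setT (EFin \o U) by exact/measurable_EFinP.
have PD : P D \is a fin_num by exact: fin_num_measure.
have k0 : (0 <= fine (P D))%R by exact: fine_ge0.
pose k := NngNum k0.
pose f (y : R) := (Num.max y 0)%:E.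
have fU : f \o U = EFin \o U.
  by apply/funext => w; rewrite /f /= max_l.
have mf : measurable_fun setT f.
  by apply/measurable_EFinP; exact: measurable_maxr.
have f0 y : 0 <= f y by rewrite lee_fin le_max lexx orbT.
have -> : \int[P]_(w in D) (U w)%:E = \int[mrestr P mD]_w (U w)%:E.
  rewrite (eq_measure_integral (mrestr P mD)); last first.
    by move=> A mA AD; rewrite /= /mrestr setIidl.
  rewrite [RHS](@ge0_negligible_integral _ _ _ _ _ (~` D))//.
  - by rewrite setDE setCK setTI.
  - exact: measurableC.
  - by move=> w _; rewrite lee_fin.
  - by rewrite /= /mrestr setICl measure0.
have f0' : {in [set: R], forall y, 0 <= f y} by move=> y _.
have := @ge0_integral_pushforward _ _ _ _ _ _ mU (mrestr P mD) _ _ measurableT mf f0'.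
have := @ge0_integral_pushforward _ _ _ _ _ _ mU P _ _ measurableT mf f0'.
rewrite !preimage_setT fU /= => <- <-.
rewrite -[P D]fineK// -(ge0_integral_mscale _ _ k)//.
apply: eq_measure_integral => A mA _.
by rewrite /= /mscale /pushforward /mrestr /= indep// fineK// muleC.
Qed.

End Independence.

Section Past.
Context d (T : measurableType d) (R : realType) (P : probability T R).
Variable Y : nat -> {RV P >-> R}.

Definition cylinders (n : nat) : set (set T) :=
  [set A | exists2 B : nat -> set R, forall k, measurable (B k) &
     A = \big[setI/setT]_(k <- iota 1 n) (Y k @^-1` B k)].

Definition past n := g_sigma_algebraType (cylinders n).

Lemma cylinders_measurable n : cylinders n `<=` measurable.
Proof.
move=> _ [B mB ->]; apply: big_rec; first exact: measurableT.
move=> k A _ mA; apply: measurableI => //.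
by rewrite -[_ @^-1` _]setTI; exact: measurable_funP.
Qed.

Lemma past_measurable n (A : set T) :
  measurable (A : set (past n)) -> measurable A.
Proof.
apply: smallest_sub; [exact: sigma_algebra_measurable|exact: cylinders_measurable].
Qed.

Lemma past_measurable_fun n d' (T' : measurableType d') (f : T -> T') :
  measurable_fun [set: past n] (f : past n -> T') -> measurable_fun setT f.
Proof. by move=> mf _ A mA; apply: (@past_measurable n); exact: mf. Qed.

Lemma cylindersT n : cylinders n setT.
Proof.
by exists (fun=> setT) => //; rewrite big1// => k _; rewrite preimage_setT.
Qed.

Lemma cylindersI n : setI_closed (cylinders n).
Proof.
move=> _ _ [A mA ->] [B mB ->]; exists (fun k => A k `&` B k).
  by move=> k; exact: measurableI.
by rewrite -big_split; apply: eq_bigr => k _; rewrite preimage_setI.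
Qed.

Lemma past_coordinate n k : (0 < k <= n)%N ->
  measurable_fun [set: past n] (Y k : past n -> R).
Proof.
move=> /andP[k0 kn] _ B mB; rewrite setTI; apply: sub_sigma_algebra.
exists (fun j => if j == k then B else setT) => [j|]; first by case: ifP.
have kin : k \in iota 1 n by rewrite mem_iota k0 add1n ltnS.
rewrite (big_rem k)//= eqxx big_seq big1 ?setIT// => j.
have [->|jk] := eqVneq j k; last by rewrite preimage_setT.
by rewrite mem_rem_uniq ?iota_uniq// inE eqxx.
Qed.

Hypothesis indepY : mutually_independent_from1 Y.

Lemma past_indep n (A : set T) (B : set R) :
  measurable (A : set (past n)) -> measurable B ->
  P (A `&` Y n.+1 @^-1` B) = (P A * P (Y n.+1 @^-1` B))%E.
Proof.
move=> mA mB; set D := Y n.+1 @^-1` B.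
have mD : measurable D by rewrite -[D]setTI; exact: measurable_funP.
have PD : P D \is a fin_num by exact: fin_num_measure.
have k0 : (0 <= fine (P D))%R by exact: fine_ge0.
pose m1 : {measure set T -> \bar R} := mrestr P mD.
pose m2 : {measure set T -> \bar R} := mscale (NngNum k0) P.
suff : m1 A = m2 A by rewrite /= /mscale /mrestr/= fineK// muleC.
apply: (@g_sigma_algebra_measure_unique _ _ _ (cylinders n) _ (fun=> setT)) mA.
- exact: cylinders_measurable.
- by move=> _; exact: cylindersT.
- by rewrite bigcup_const//; exists 0%N.
- exact: cylindersI.
- move=> _ [C mC ->]; rewrite /= /mscale /mrestr/= fineK// muleC.
  pose C' k := if k == n.+1 then B else C k.
  have mC' k : measurable (C' k) by rewrite /C'; case: ifP.
  have C'n : C' n.+1 = B by rewrite /C' eqxx.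
  have C'E k : k \in iota 1 n -> C' k = C k.
    by rewrite mem_iota add1n ltnS /C' => /andP[_ kn]; rewrite ltn_eqF// ltnS.
  have E1 : \big[setI/setT]_(k <- iota 1 n) (Y k @^-1` C' k) =
            \big[setI/setT]_(k <- iota 1 n) (Y k @^-1` C k).
    by apply: eq_big_seq => k /C'E ->.
  have iota_gt0 : all (fun k => (0 < k)%N) (iota 1 n).
    by apply/allP => k; rewrite mem_iota => /andP[].
  have nin : n.+1 \notin iota 1 n by rewrite mem_iota add1n ltnn andbF.
  have := @indepY (n.+1 :: iota 1 n) C'.
  rewrite /= nin iota_uniq iota_gt0 => /(_ isT isT mC').
  rewrite !big_cons C'n E1 setIC => ->; rewrite -indepY ?iota_uniq//.
  by rewrite E1 muleC.
- by move=> _; rewrite /m1 /= /mrestr setTI ltey_eq PD.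
Qed.

End Past.

(** * Normal laws *)

Section NormalMoments.
Context {R : realType}.
Variables m s : R.
Hypothesis s0 : 0 < s.
Local Notation mu := (@lebesgue_measure R).

Let s_neq0 : s != 0. Proof. by rewrite gt_eqF. Qed.

Lemma ge0_integral_normal_prob (f : R -> \bar R) :
  measurable_fun setT f -> (forall x, 0 <= f x)%E ->
  (\int[normal_prob m s]_x f x = \int[mu]_x (f x * (normal_pdf m s x)%:E))%E.
Proof.
move=> mf f0.
have dom := normal_prob_dominates m s.
rewrite -(Radon_Nikodym_SigmaFinite.change_of_variables dom)//.
have RNint := Radon_Nikodym_SigmaFinite.f_integrable dom.
have mpdf : measurable_fun setT (fun x => (normal_pdf m s x)%:E).
  by apply/measurable_EFinP; exact: measurable_normal_pdf.
apply: ae_eq_integral => //.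
- by apply: emeasurable_funM => //; exact: measurable_int RNint.
- exact: emeasurable_funM.
- apply: ae_eqe_mul2l; apply: integral_ae_eq => //.
  by move=> E _ mE; rewrite -Radon_Nikodym_SigmaFinite.f_integral.
Qed.

Lemma normal_prob_itv_gt0 (a b : R) : a < b ->
  (0 < normal_prob m s `]a, b]%classic)%E.
Proof.
move=> ab; rewrite /normal_prob normal_pdfE//.
pose e := expR (- ((a - m) ^+ 2 + (b - m) ^+ 2) / (s ^+ 2 *+ 2)).
have e0 : 0 < normal_peak s * e by rewrite mulr_gt0 ?expR_gt0 ?normal_peak_gt0.
apply: (@lt_le_trans _ _ (\int[mu]_(x in `]a, b]) (normal_peak s * e)%:E)%E).
  rewrite integral_cst//= lebesgue_measure_itv/= lte_fin ab -EFinB -EFinM lte_fin.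
  by rewrite mulr_gt0// subr_gt0.
apply: ge0_le_integral => //=.
- by move=> x _; rewrite lee_fin ltW.
- apply/measurable_EFinP/measurable_funTS.
  by apply: measurable_funM => //; exact: measurable_normal_fun.
move=> x; rewrite in_itv/= => /andP[ax xb].
rewrite lee_fin ler_wpM2l ?normal_peak_ge0// /normal_fun ler_expR.
rewrite ler_wpM2r ?invr_ge0 ?mulrn_wge0 ?sqr_ge0// lerN2.
have [xm|/ltW xm] := leP m x.
  apply: ler_wpDl; first exact: sqr_ge0.
  by rewrite ler_sqr ?nnegrE; lra.
apply: ler_wpDr; first exact: sqr_ge0.
by rewrite -(sqrrN (x - m)) -(sqrrN (a - m)) ler_sqr ?nnegrE; lra.
Qed.

Lemma normal_prob_abs_moment_lty :
  (\int[normal_prob m s]_x (`|x|)%:E < +oo)%E.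
Proof.
have mabs : measurable_fun [set: R] (fun x : R => (`|x|)%:E).
  by apply/measurable_EFinP; exact: normr_measurable.
rewrite ge0_integral_normal_prob//.
pose s' := Num.sqrt 2 * s.
have s'0 : 0 < s' by rewrite mulr_gt0// sqrtr_gt0.
pose c := s * normal_peak s / normal_peak s'.
have c0 : 0 <= c by rewrite !mulr_ge0 ?invr_ge0 ?normal_peak_ge0// ltW.
have mpdf u : measurable_fun setT (fun x => (normal_pdf m u x)%:E).
  by apply/measurable_EFinP; exact: measurable_normal_pdf.
have mcpdf k u : measurable_fun setT (fun x => (k%:E * (normal_pdf m u x)%:E)%E).
  by apply: emeasurable_funM => //; exact: mpdf.
have pdf0 u x : (0 <= (normal_pdf m u x)%:E)%E by rewrite lee_fin normal_pdf_ge0.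
apply: (@le_lt_trans _ _ (\int[mu]_x
   ((`|m|)%:E * (normal_pdf m s x)%:E + c%:E * (normal_pdf m s' x)%:E))%E).
  apply: ge0_le_integral => [//|x _| | |x _].
  - by rewrite mule_ge0.
  - exact: (emeasurable_funM mabs (mpdf s)).
  - exact: (emeasurable_funD (mcpdf _ _) (mcpdf _ _)).
  rewrite -!EFinM -EFinD lee_fin.
  have -> : c * normal_pdf m s' x =
      s * normal_peak s * expR (- (x - m) ^+ 2 / (s ^+ 2 *+ 4)).
    rewrite (normal_pdfE _ (lt0r_neq0 s'0)) /c mulrA divfK; last first.
      by rewrite gt_eqF// normal_peak_gt0// gt_eqF.
    rewrite /normal_fun /s' exprMn sqr_sqrtr//; congr (_ * expR (_ / _)); ring.
  rewrite (normal_pdfE _ s_neq0) /normal_fun.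
  set t := x - m; set u := - t ^+ 2 / (s ^+ 2 *+ 4).
  have -> : - t ^+ 2 / (s ^+ 2 *+ 2) = u + u by rewrite /u; field.
  rewrite expRD.
  have pk0 := normal_peak_ge0 s; set pk := normal_peak s in pk0 *.
  have tE : `|t| * expR u <= s.
    have : 1 - u <= expR (- u) by exact: expR_ge1Dx.
    rewrite expRN => h.
    rewrite -ler_pdivlMr ?expR_gt0//.
    apply: le_trans (ler_wpM2l (ltW s0) h).
    rewrite /u -(real_normK (num_real t)).
    have -> : s * (1 - - `|t| ^+ 2 / (s ^+ 2 *+ 4)) = s + `|t| ^+ 2 / (s * 4).
      by field.
    rewrite -subr_ge0.
    have -> : s + `|t| ^+ 2 / (s * 4) - `|t| = (s *+ 2 - `|t|) ^+ 2 / (s * 4).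
      by field.
    by rewrite divr_ge0 ?sqr_ge0// mulr_ge0// ltW.
  have xE : `|x| <= `|m| + `|t|.
    by rewrite /t; apply: le_trans (ler_normD _ _); rewrite addrC subrK.
  have eu0 := expR_ge0 u; set eu := expR u in eu0 tE *.
  apply: (@le_trans _ _ ((`|m| + `|t|) * (pk * (eu * eu)))).
    by rewrite ler_wpM2r// !mulr_ge0.
  rewrite mulrDl lerD2l (_ : _ * _ = (`|t| * eu) * (pk * eu)); last by ring.
  by rewrite -[leRHS]mulrA ler_wpM2r// mulr_ge0.
rewrite ge0_integralD//; last 4 first.
- by move=> x _; rewrite mule_ge0.
- exact: mcpdf.
- by move=> x _; rewrite mule_ge0.
- exact: mcpdf.
have intpdf k u : 0 <= k -> (\int[mu]_x (k%:E * (normal_pdf m u x)%:E) = k%:E)%E.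
  move=> k0; rewrite ge0_integralZl_EFin//; last exact: mpdf.
  by rewrite integral_normal_pdf mule1.
by rewrite !intpdf// -EFinD ltry.
Qed.

End NormalMoments.

(** * A dominating chain and its Lyapunov function *)

Section NonnegativeIntegrals.
Context d (T : measurableType d) (R : realType) (mu : {measure set T -> \bar R}).
Local Open Scope ereal_scope.
Variables (A : set T) (f g : T -> R).
Hypotheses (mA : measurable A) (mf : measurable_fun setT f)
  (mg : measurable_fun setT g).
Hypotheses (f0 : forall w, (0 <= f w)%R) (g0 : forall w, (0 <= g w)%R).

Let measurable_EFin_comp (h : T -> R) :
  measurable_fun setT h -> measurable_fun A (fun w => (h w)%:E).
Proof. by move=> mh; apply: measurable_funTS; exact/measurable_EFinP. Qed.

Lemma ge0_integralZl_real (k : R) : (0 <= k)%R ->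
  \int[mu]_(w in A) (k * f w)%:E = k%:E * \int[mu]_(w in A) (f w)%:E.
Proof.
move=> k0; rewrite -ge0_integralZl_EFin//.
- by move=> w _; rewrite lee_fin.
- exact: measurable_EFin_comp.
Qed.

Lemma ge0_integralD_real : \int[mu]_(w in A) (f w + g w)%:E =
  \int[mu]_(w in A) (f w)%:E + \int[mu]_(w in A) (g w)%:E.
Proof.
rewrite -ge0_integralD//.
- by move=> w _; rewrite lee_fin.
- exact: measurable_EFin_comp.
- by move=> w _; rewrite lee_fin.
- exact: measurable_EFin_comp.
Qed.

Lemma ge0_le_integral_real : (forall w, A w -> (f w <= g w)%R) ->
  \int[mu]_(w in A) (f w)%:E <= \int[mu]_(w in A) (g w)%:E.
Proof.
move=> fg; apply: ge0_le_integral => //.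
- by move=> w _; rewrite lee_fin.
- exact: measurable_EFin_comp.
- exact: measurable_EFin_comp.
Qed.

Lemma ge0_subset_integral_real (B : set T) : measurable B -> A `<=` B ->
  \int[mu]_(w in A) (f w)%:E <= \int[mu]_(w in B) (f w)%:E.
Proof.
move=> mB AB; apply: ge0_subset_integral => //.
- by apply: measurable_funTS; exact/measurable_EFinP.
- by move=> w _; rewrite lee_fin.
Qed.

Lemma ge0_integral_setU_real (B : set T) : measurable B -> [disjoint A & B] ->
  \int[mu]_(w in A `|` B) (f w)%:E =
  \int[mu]_(w in A) (f w)%:E + \int[mu]_(w in B) (f w)%:E.
Proof.
move=> mB AB; rewrite ge0_integral_setU//.
- by apply: measurable_funTS; exact/measurable_EFinP.
- by move=> w _; rewrite lee_fin.
Qed.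

End NonnegativeIntegrals.

Section Domination.
Context d (T : measurableType d) (R : realType) (P : probability T R).
Variables (Y : nat -> {RV P >-> R}) (r K a x : R).

Fixpoint dominant n (w : T) : R :=
  if n is n'.+1 then r * (dominant n' w + K * `|Y n w|) else 0.

Fixpoint survival n : set T :=
  if n is n'.+1
  then survival n' `&` [set w | a * Y n w <= x + dominant n' w] else setT.

Lemma measurable_dominant n k : (n <= k)%N ->
  measurable_fun [set: past Y k] (dominant n : past Y k -> R).
Proof.
elim: n => [|n IHn] nk; first exact: measurable_cst.
apply: measurable_funM; first exact: measurable_cst.
apply: measurable_funD; first exact: (IHn (ltnW nk)).
apply: measurable_funM; first exact: measurable_cst.
by apply: measurableT_comp => //; exact: past_coordinate.
Qed.

Lemma measurable_survival n k : (n <= k)%N ->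
  measurable (survival n : set (past Y k)).
Proof.
elim: n => [|n IHn] nk; first exact: measurableT.
apply: measurableI; first exact: (IHn (ltnW nk)).
rewrite -[X in measurable X]setTI.
apply: (@measurable_fun_le _ (past Y k)) => //.
- by apply: measurable_funM; [exact: measurable_cst|exact: past_coordinate].
- apply: measurable_funD; first exact: measurable_cst.
  exact: (measurable_dominant (ltnW nk)).
Qed.

Hypotheses (r0 : 0 <= r) (K0 : 0 <= K).

Lemma dominant_ge0 n w : 0 <= dominant n w.
Proof. by elim: n => //= n IHn; rewrite mulr_ge0// addr_ge0// mulr_ge0. Qed.

Hypothesis indepY : mutually_independent_from1 Y.

Variables (eps L B p c q : R).
Hypotheses (eps0 : 0 <= eps) (c0 : 0 <= c) (a0 : 0 < a) (xLB : x + L <= a * B).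
Hypothesis momY : forall k, (0 < k)%N -> (\int[P]_w (`|Y k w|)%:E <= c%:E)%E.
Hypothesis probY : forall k, (0 < k)%N ->
  (P (Y k @^-1` `]-oo, B]%classic) <= p%:E)%E.
Hypothesis contr_far : forall z, L <= z ->
  1 + eps * r * z + eps * r * K * c <= q * (1 + eps * z).
Hypothesis contr_near : forall z, 0 <= z ->
  p * (1 + eps * r * z) + eps * r * K * c <= q * (1 + eps * z).
Hypothesis q0 : 0 <= q.

Local Open Scope ereal_scope.

Definition lyapunov n := \int[P]_(w in survival n) (1 + eps * dominant n w)%:E.

(* Far from the origin the dominant contracts on average; near it, survival
   costs a factor [p], because it forces the next variable below [B]. *)
Lemma lyapunov_step n : lyapunov n.+1 <= q%:E * lyapunov n.
Proof.
rewrite /lyapunov; set F := survival n; set Z := dominant n.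
set y := Y n.+1 : T -> R.
have p0 : (0 <= p)%R by rewrite -lee_fin; apply: le_trans (probY (ltn0Sn 0)).
have mF' : measurable (F : set (past Y n)) by exact: measurable_survival.
have mF : measurable F by exact: past_measurable mF'.
have mZ' : measurable_fun [set: past Y n] (Z : past Y n -> R).
  exact: measurable_dominant.
have mZ : measurable_fun setT Z by exact: past_measurable_fun mZ'.
have Z0 w : (0 <= Z w)%R by exact: dominant_ge0.
have my : measurable_fun setT y by exact: measurable_funP.
have mS : measurable (survival n.+1).
  exact: (past_measurable (measurable_survival (leqnn n.+1))).
have mfar' : measurable ([set w | L <= Z w]%R : set (past Y n)).
  rewrite -[X in measurable X]setTI.
  by apply: (@measurable_fun_le _ (past Y n)) => //; exact: measurable_cst.
set far := [set w | L <= Z w]%R in mfar'.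
pose F1 := F `&` far; pose F2 := F `&` ~` far.
have mF1 : measurable F1.
  by apply: (@past_measurable _ _ _ _ Y n); exact: measurableI.
have mF2' : measurable (F2 : set (past Y n)).
  by apply: measurableI => //; exact: measurableC.
have mF2 : measurable F2 by exact: past_measurable mF2'.
have F12 : F = F1 `|` F2 by rewrite -setIUr setUv setIT.
have disj : [disjoint F1 & F2].
  by apply/disj_setPS => w [[_ h] [_ /(_ h)]].
pose W w : R := (1 + eps * r * Z w)%R.
have W0 w : (0 <= W w)%R by rewrite addr_ge0// !mulr_ge0.
have mW : measurable_fun setT W.
  apply: measurable_funD; first exact: measurable_cst.
  by apply: measurable_funM => //; exact: measurable_cst.
pose V w : R := (1 + eps * Z w)%R.
have V0 w : (0 <= V w)%R by rewrite addr_ge0// !mulr_ge0.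
have mV : measurable_fun setT V.
  apply: measurable_funD; first exact: measurable_cst.
  by apply: measurable_funM => //; exact: measurable_cst.
pose D := y @^-1` `]-oo, B]%classic.
have mD : measurable D by rewrite -[D]setTI; exact: my.
pose k := (eps * r * K)%R.
have k0 : (0 <= k)%R by rewrite !mulr_ge0.
have my1 : measurable_fun setT (fun w => `|y w|%R) by exact: measurableT_comp.
have ->: \int[P]_(w in survival n.+1) (1 + eps * dominant n.+1 w)%:E =
    \int[P]_(w in survival n.+1) (W w)%:E +
    k%:E * \int[P]_(w in survival n.+1) (`|y w|)%:E.
  have mky : measurable_fun setT (fun w => k * `|y w|)%R.
    by apply: measurable_funM => //; exact: measurable_cst.
  rewrite -ge0_integralZl_real// -ge0_integralD_real//; last first.
    by move=> w; rewrite mulr_ge0.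
  apply: eq_integral => w _; congr (_%:E).
  rewrite (_ : dominant n.+1 w = r * (Z w + K * `|y w|))%R// /W /k.
  by ring.
have step1 : \int[P]_(w in survival n.+1) (W w)%:E <=
    \int[P]_(w in F1) (W w)%:E + p%:E * \int[P]_(w in F2) (W w)%:E.
  apply: (@le_trans _ _ (\int[P]_(w in F1 `|` (F2 `&` D)) (W w)%:E)).
    apply: ge0_subset_integral_real => //.
    - by apply: measurableU => //; exact: measurableI.
    - move=> w [Fw yw]; have [Lw|Lw] := leP L (Z w); [left|right] => //.
      split; first by split => //; apply/negP; rewrite -ltNge.
      rewrite /D /= in_itv /= -(ler_pM2l a0).
      apply: le_trans yw _; apply: le_trans xLB; rewrite lerD2l; exact: ltW.
  rewrite ge0_integral_setU_real//; last 2 first.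
  - exact: measurableI.
  - by apply/disj_setPS => w [[_ h] [[_ /(_ h)]]].
  apply: leeD2l.
  rewrite setIC.
  pose U w : R := (\1_F2 w * W w)%R.
  have U0 w : (0 <= U w)%R by rewrite mulr_ge0.
  have mU' : measurable_fun [set: past Y n] (U : past Y n -> R).
    apply: measurable_funM; first exact: measurable_indic.
    apply: measurable_funD; first exact: measurable_cst.
    by apply: measurable_funM => //; exact: measurable_cst.
  have UE A : \int[P]_(w in A `&` F2) (W w)%:E = \int[P]_(w in A) (U w)%:E.
    rewrite integral_mkcondr; apply: eq_integral => w _.
    by rewrite /U patchE indicE; case: ifP; rewrite ?mul1r ?mul0r.
  rewrite UE -[F2]setTI UE integral_indep_event//.
  - rewrite lee_wpmul2r ?probY// integral_ge0// => w _.
    by rewrite lee_fin.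
  - exact: past_measurable_fun mU'.
  - move=> A mA; rewrite (past_indep indepY)//.
    by rewrite -[X in measurable X]setTI; exact: mU'.
have step2 : \int[P]_(w in survival n.+1) (`|y w|)%:E <= c%:E * P F.
  apply: (@le_trans _ _ (\int[P]_(w in F) (`|y w|)%:E)).
    by apply: ge0_subset_integral_real => // w [].
  rewrite integral_indep_event//; last first.
    move=> A mA.
    rewrite [_ @^-1` _](_ : _ = y @^-1` (Num.norm @^-1` A))// setIC.
    rewrite (past_indep indepY) 1?muleC//.
    by rewrite -[X in measurable X]setTI; exact: normr_measurable.
  by rewrite muleC lee_wpmul2r ?momY.
have -> : \int[P]_(w in F) (1 + eps * Z w)%:E =
    \int[P]_(w in F1) (V w)%:E + \int[P]_(w in F2) (V w)%:E.
  by rewrite {1}F12 ge0_integral_setU_real.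
have PF : P F = P F1 + P F2 by rewrite {1}F12 measureU//; exact/eqP.
have kc0 : (0 <= k * c)%R by rewrite mulr_ge0.
have comp (u : R) (A : set T) : (0 <= u)%R -> measurable A ->
    (forall w, A w -> u * W w + k * c <= q * V w)%R ->
    u%:E * \int[P]_(w in A) (W w)%:E + (k * c)%:E * P A <=
    q%:E * \int[P]_(w in A) (V w)%:E.
  move=> u0 mA h.
  have muW : measurable_fun setT (fun w => u * W w)%R.
    by apply: measurable_funM => //; exact: measurable_cst.
  have mqV : measurable_fun setT (fun w => q * V w)%R.
    by apply: measurable_funM => //; exact: measurable_cst.
  have uW0 w : (0 <= u * W w)%R by rewrite mulr_ge0.
  rewrite -integral_cst// -!ge0_integralZl_real//.
  rewrite -(ge0_integralD_real P mA muW (measurable_cst (k * c)%R) uW0 (fun=> kc0)).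
  apply: ge0_le_integral_real => //.
  - by apply: measurable_funD.
  - by move=> w; rewrite addr_ge0.
have far1 := comp 1%R F1 ler01 mF1.
have near2 := comp p F2 p0 mF2.
apply: (@le_trans _ _ ((\int[P]_(w in F1) (W w)%:E + p%:E * \int[P]_(w in F2) (W w)%:E)
  + (k%:E * (c%:E * P F)))).
  by apply: leeD => //; apply: lee_wpmul2l.
have V1 A : 0 <= \int[P]_(w in A) (V w)%:E.
  by apply: integral_ge0 => w _; rewrite lee_fin.
rewrite muleA -EFinM PF (ge0_muleDr _ (measure_ge0 P F1) (measure_ge0 P F2)).
rewrite (ge0_muleDr _ (V1 F1) (V1 F2)).
rewrite addeACA; apply: leeD.
- rewrite -[X in X + _]mul1e; apply: far1 => w [_ Lw].
  by rewrite mul1r; exact: contr_far.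
- by apply: near2 => w _; exact: contr_near.
Qed.

Lemma survival_prob_le n : P (survival n) <= (q ^+ n)%:E.
Proof.
have mS : measurable (survival n).
  exact: (past_measurable (measurable_survival (leqnn n))).
apply: (@le_trans _ _ (lyapunov n)).
  rewrite -[leLHS]mul1e -integral_cst//; apply: ge0_le_integral => //.
  - apply: measurable_funTS; apply/measurable_EFinP.
    apply: measurable_funD; first exact: measurable_cst.
    apply: measurable_funM; first exact: measurable_cst.
    exact: past_measurable_fun (measurable_dominant (leqnn n)).
  - by move=> w _; rewrite lee_fin lerDl mulr_ge0// dominant_ge0.
elim: n {mS} => [|n IHn].
  rewrite /lyapunov /=; under eq_integral do rewrite mulr0 addr0.
  by rewrite integral_cst// mul1e expr0 probability_le1.
apply: (le_trans (lyapunov_step n)).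
by rewrite exprS EFinM lee_wpmul2l.
Qed.

End Domination.

Lemma contraction_constants (R : realFieldType) (r c p : R) :
  0 <= r -> r < 1 -> 0 <= c -> 0 <= p -> p < 1 ->
  exists eps q : R, [/\ 0 <= eps, 0 < q < 1,
    forall z : R, (c *+ 2 + 1) / (1 - r) <= z ->
      1 + eps * r * z + eps * c <= q * (1 + eps * z) &
    forall z : R, 0 <= z -> p * (1 + eps * r * z) + eps * c <= q * (1 + eps * z)].
Proof.
move=> r0 r1 c0 p0 p1; set L := _ / _.
have r1' : 0 < 1 - r by rewrite subr_gt0.
have L0 : 0 < L by rewrite divr_gt0// ltr_wpDl// mulrn_wge0.
have LE : (1 - r) * L = c *+ 2 + 1 by rewrite /L mulrC divfK// gt_eqF.
have c21 : 0 < c *+ 2 + 1 by rewrite ltr_wpDl// mulrn_wge0.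
have [eps eps0 epsE] : exists2 eps : R, 0 < eps & eps * (c *+ 2 + 1) = 1 - p.
  by exists ((1 - p) / (c *+ 2 + 1)); rewrite ?divr_gt0 ?subr_gt0// divfK// gt_eqF.
pose s := (1 + r) / 2.
pose q1 := (1 + eps * s * L) / (1 + eps * L).
have epsL : 0 < eps * L by rewrite mulr_gt0.
have s0 : 0 < s by rewrite /s; lra.
have s1 : s < 1 by rewrite /s; lra.
have epssL : 0 < eps * s * L by exact: mulr_gt0 (mulr_gt0 eps0 s0) L0.
have q1_gt0 : 0 < q1 by rewrite divr_gt0// addr_gt0.
have q1_lt1 : q1 < 1.
  by rewrite /q1 ltr_pdivrMr ?addr_gt0// mul1r ltrD2l mulrAC gtr_pMr.
pose q2 := p + eps * c.
have q2_lt1 : q2 < 1.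
  have : 0 <= eps * c by rewrite mulr_ge0// ltW.
  by rewrite /q2; lra.
exists eps, (Num.max q1 q2); split.
- exact: ltW.
- by rewrite lt_max q1_gt0 gt_max q1_lt1.
- move=> z Lz.
  have z0 : 0 < z by exact: lt_le_trans Lz.
  apply: (@le_trans _ _ (q1 * (1 + eps * z))); last first.
    by rewrite ler_wpM2r ?le_max ?lexx// addr_ge0// mulr_ge0// ltW.
  apply: (@le_trans _ _ (1 + eps * s * z)).
    rewrite -addrA lerD2l -!mulrA -mulrDr ler_pM2l//.
    have : (1 - r) * L <= (1 - r) * z by rewrite ler_pM2l.
    rewrite LE /s; lra.
  rewrite /q1 [leRHS]mulrAC ler_pdivlMr ?addr_gt0// -subr_ge0.
  have -> : (1 + eps * s * L) * (1 + eps * z) - (1 + eps * s * z) * (1 + eps * L)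
     = eps * (z - L) * (1 - s) by ring.
  by rewrite mulr_ge0 ?subr_ge0 ?(ltW s1)// mulr_ge0 ?subr_ge0// ltW.
- move=> z z0.
  have ez : 0 <= eps * z by rewrite mulr_ge0// ltW.
  apply: (@le_trans _ _ (q2 * (1 + eps * z))); last first.
    by rewrite ler_wpM2r ?le_max ?lexx ?orbT// addr_ge0.
  rewrite /q2 mulrDl; apply: lerD.
    by rewrite ler_wpM2l// lerD2l -mulrA ler_pM2l// ler_piMl// ltW.
  by rewrite ler_peMr ?lerDl// mulr_ge0// ltW.
Qed.

Section ExponentialDecay.
Context d (T : measurableType d) (R : realType) (P : probability T R).
Variables (Y : nat -> {RV P >-> R}) (r K a x c : R).
Hypotheses (r0 : 0 <= r) (r1 : r < 1) (K0 : 0 <= K) (a0 : 0 < a) (c0 : 0 <= c).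
Hypothesis indepY : mutually_independent_from1 Y.
Hypothesis momY : forall k, (0 < k)%N -> (\int[P]_w (`|Y k w|)%:E <= c%:E)%E.
Hypothesis tailY : forall B : R, exists2 p : R, p < 1 &
  forall k, (0 < k)%N -> (P (Y k @^-1` `]-oo, B]%classic) <= p%:E)%E.

Lemma survival_exp_decay : exists2 q : R, 0 < q < 1 &
  forall n, (P (survival Y r K a x n) <= (q ^+ n)%:E)%E.
Proof.
pose c' := r * K * c.
have c'0 : 0 <= c' by rewrite !mulr_ge0.
have kE e : e * r * K * c = e * c' by rewrite /c' !mulrA.
pose L := (c' *+ 2 + 1) / (1 - r).
have [p p1 probY] := tailY ((x + L) / a).
have p0 : 0 <= p.
  by rewrite -lee_fin; apply: le_trans (probY 1%N isT).
have [e [q [e0 q01 far near]]] := contraction_constants r0 r1 c'0 p0 p1.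
exists q => // n.
apply: (@survival_prob_le _ _ _ _ _ _ _ _ _ _ _ _ e L ((x + L) / a) p c) => //.
- by rewrite mulrC divfK// gt_eqF.
- by move=> z Lz; rewrite kE; exact: far.
- by move=> z z0; rewrite kE; exact: near.
- by case/andP: q01 => /ltW.
Qed.

End ExponentialDecay.

(** * The weighted process *)

Section Process.
Context d (T : measurableType d) (R : realType) (P : probability T R).
Variables (Y : nat -> {RV P >-> R}) (alpha : nat -> R) (rho : R).

Lemma dominantE (r K : R) n w : dominant Y r K n w =
  \sum_(1 <= k < n.+1) r ^+ (n.+1 - k) * K * `|Y k w|.
Proof.
elim: n => [|n IHn]; first by rewrite big_geq.
rewrite big_nat_recr//= IHn mulrDr mulr_sumr subSnn expr1 !mulrA; congr (_ + _).
apply: eq_big_nat => k /andP[_ kn].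
by rewrite [in RHS]subSn ?exprS ?mulrA// ltnW.
Qed.

Lemma Xproc_lower_bound (r K : R) n w :
  (forall j, `|alpha j * rho ^+ j| <= K * r ^+ j) ->
  alpha 0%N * Y n.+1 w - dominant Y r K n w <= Xproc Y alpha rho n.+1 w.
Proof.
move=> aK; rewrite /Xproc big_nat_recr//= subnn expr0 mulr1 [leRHS]addrC.
rewrite lerD2l lerNl dominantE -sumrN; apply: ler_sum_nat => k _.
rewrite (mulrC _ K); apply: le_trans (ler_wpM2r (normr_ge0 _) (aK _)).
by rewrite -normrM; apply: le_trans (ler_norm _) _; rewrite normrN.
Qed.

Lemma sup_le_event_sub_survival (r K x : R) N :
  (forall j, `|alpha j * rho ^+ j| <= K * r ^+ j) ->
  sup_le_event Y alpha rho N x `<=` survival Y r K (alpha 0%N) x N.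
Proof.
move=> aK w; elim: N => [//|N IHN] h /=; split.
  by apply: IHN => n /andP[n1 nN]; apply: h; rewrite n1 (leq_trans nN).
have := h N.+1; rewrite leqnn => /(_ isT).
by have := Xproc_lower_bound N w aK; lra.
Qed.

Lemma measurable_sup_le_event x N : measurable (sup_le_event Y alpha rho N x).
Proof.
have -> : sup_le_event Y alpha rho N x =
    \big[setI/setT]_(n <- iota 1 N) [set w | Xproc Y alpha rho n w <= x].
  rewrite -bigcap_seq; apply/seteqP; split => w h n /=.
    by rewrite mem_iota add1n ltnS => /h.
  by move=> nN; apply: (h n); rewrite /= mem_iota add1n ltnS.
apply: bigsetI_measurable => n _; rewrite -[X in measurable X]setTI.
apply: measurable_fun_le => //.
rewrite /Xproc; apply: measurable_sum => k.
by apply: measurable_funM.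
Qed.

Hypothesis alpha_gt0 : forall n, 0 < alpha n.
Hypothesis rho_ge0 : 0 <= rho.

Lemma sup_le_event_gt0 x N : mutually_independent_from1 Y ->
  (forall k B, (0 < k)%N -> 0 < P (Y k @^-1` `]-oo, B]%classic))%E ->
  (0 < P (sup_le_event Y alpha rho N x))%E.
Proof.
move=> indepY lowY.
pose M := Num.max 0 (- x / alpha 0%N).
have M0 : 0 <= M by rewrite le_max lexx.
pose low k := Y k @^-1` `]-oo, (- M)]%classic.
have mlow k : measurable (low k) by rewrite -[low k]setTI; exact: measurable_funP.
apply: (@lt_le_trans _ _ (P (\big[setI/setT]_(k <- iota 1 N) low k))).
  rewrite indepY ?iota_uniq//; last first.
    by apply/allP => k; rewrite mem_iota => /andP[].
  rewrite big_seq; apply: (big_ind (fun y => 0 < y)%E) => //.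
  - by move=> ? ?; exact: mule_gt0.
  - by move=> k; rewrite mem_iota => /andP[k0 _]; exact: lowY.
rewrite le_measure ?inE//.
- by apply: bigsetI_measurable => k _.
- exact: measurable_sup_le_event.
rewrite -bigcap_seq => w h [//|n] /andP[_ nN].
have Yw k : (0 < k <= N)%N -> Y k w <= - M.
  move=> kN; have := h k; rewrite /low /= mem_iota add1n ltnS => /(_ kN).
  by rewrite in_itv.
rewrite /Xproc big_nat_recr//= subnn expr0 mulr1 -[leRHS]add0r; apply: lerD.
  rewrite big_nat; apply: sumr_le0 => k /andP[k0 kn].
  rewrite mulr_ge0_le0 ?mulr_ge0 ?exprn_ge0 ?(ltW (alpha_gt0 _))//.
  by apply: le_trans (Yw k _) _; rewrite ?oppr_le0// k0 ltnW// (leq_trans _ nN).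
apply: (@le_trans _ _ (alpha 0%N * - M)); first by rewrite ler_pM2l// Yw.
rewrite mulrN lerNl -ler_pdivrMl// mulrC /M.
by rewrite le_max lexx orbT.
Qed.

End Process.

Lemma limn_einf_gt0_exp_decay (R : realType) (u : nat -> R) (q : R) :
  0 < q < 1 -> (forall n, 0 < u n <= q ^+ n) ->
  (0 < limn_einf (fun n => (- n%:R^-1 * ln (u n))%:E))%E.
Proof.
move=> /andP[q0 q1] uq.
have lnq : 0 < - ln q by rewrite oppr_gt0 ln_lt0// q0.
apply: (@lt_le_trans _ _ (- ln q)%:E); first by rewrite lte_fin.
rewrite limn_einf_lim; apply: lime_ge; first exact: is_cvg_einfs.
near=> k; apply: le_ereal_inf_tmp => _ [n /= kn <-].
have n0 : (0 < n)%N by apply: leq_trans kn; near: k; exists 1%N.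
have /andP[un0 unq] := uq n.
rewrite lee_fin mulNr lerN2 ler_pdivrMl ?ltr0n// mulr_natl.
by rewrite -lnXn// ler_ln ?posrE// exprn_gt0.
Unshelve. all: by end_near. Qed.

Lemma subexponential_geometric_bound (R : realType) (rho : R) (alpha : nat -> R) :
  0 < rho < 1 ->
  (forall lam : R, 0 < lam ->
     ((fun n : nat => expR (- lam * n%:R) * alpha n) : R^nat) @ \oo --> (0 : R^o)) ->
  exists r K : R, [/\ 0 <= r < 1, 0 <= K &
    forall n, `|alpha n * rho ^+ n| <= K * r ^+ n].
Proof.
move=> /andP[rho0 rho1] sub.
pose lam := - ln rho / 2.
have lam0 : 0 < lam by rewrite divr_gt0// oppr_gt0 ln_lt0// rho0.
pose r := expR (- lam).
have r0 : 0 < r by exact: expR_gt0.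
have rE n : expR (- lam * n%:R) = r ^+ n by rewrite expRM_natr.
have rr : r * r = rho by rewrite -expRD (_ : _ + _ = ln rho) ?lnK ?posrE// /lam; field.
have cv : cvgn ((fun n : nat => expR (- lam * n%:R) * alpha n) : R^o^nat).
  by apply/cvg_ex; exists 0; exact: sub.
have [M [_ /(_ (`|M| + 1))]] := cvg_seq_bounded cv.
rewrite (le_lt_trans (ler_norm M)) ?ltrDl// => /(_ isT) bd.
exists r, (`|M| + 1); split => //.
- by rewrite ltW//= -expR0 ltr_expR oppr_lt0.
move=> n; have := bd n I; rewrite /= rE => h.
rewrite -rr exprMn mulrA (mulrC (alpha n)) normrM.
by rewrite (ger0_norm (exprn_ge0 n (ltW r0))) ler_wpM2r// exprn_ge0// ltW.
Qed.

Theorem mainTheorem13 (d : measure_display) (T : measurableType d) (R : realType)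
  (P : probability T R) (Y : nat -> {RV P >-> R}) (m s : R)
  (rho : R) (alpha : nat -> R) :
  0 < s ->
  mutually_independent_from1 Y ->
  (forall k, (0 < k)%N -> gaussian_rv (Y k) m s) ->
  0 < rho < 1 ->
  (forall n, 0 < alpha n) ->
  (exists C : R, forall n k, alpha (n + k)%N <= C * alpha n * alpha k) ->
  (forall lam : R, 0 < lam ->
     ((fun n : nat => expR (- lam * n%:R) * alpha n) : R^nat) @ \oo --> (0 : R^o)) ->
  forall x : R,
    (0 < limn_einf (fun N : nat =>
       (- (N%:R)^-1 * ln (fine (P (sup_le_event Y alpha rho N x))))%:E))%E.
Proof.
move=> s0 indepY gaussY rho01 alpha_gt0 _ sub x.
have rho0 : 0 <= rho by case/andP: rho01 => /ltW.
have [r [K [/andP[r0 r1] K0 aK]]] := subexponential_geometric_bound rho01 sub.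
have lawY k B : (0 < k)%N ->
    P (Y k @^-1` `]-oo, B]%classic) = normal_prob m s `]-oo, B]%classic.
  by move=> k0; exact: (gaussY k k0).
have moment := normal_prob_abs_moment_lty m s0.
set J := (\int[normal_prob m s]_y (`|y|)%:E)%E in moment.
have J0 : (0 <= J)%E by apply: integral_ge0 => y _; rewrite lee_fin.
have JE : (fine J)%:E = J by rewrite fineK// ge0_fin_numE.
have momY k : (0 < k)%N -> (\int[P]_w (`|Y k w|)%:E <= (fine J)%:E)%E.
  move=> k0; rewrite JE.
  have mYk : measurable_fun setT (Y k : T -> measurableTypeR R).
    by move=> _ A mA; exact: (measurable_funP (Y k)).
  have mabs : measurable_fun setT (fun y : measurableTypeR R => (`|y|)%:E).
    by apply/measurable_EFinP; exact: normr_measurable.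
  have abs0 : {in setT, forall y : measurableTypeR R, 0 <= (`|y|)%:E}%E.
    by move=> y _; rewrite lee_fin.
  have := @ge0_integral_pushforward _ _ _ _ _ _ mYk P _ _ measurableT mabs abs0.
  rewrite preimage_setT /comp => <-.
  rewrite (eq_measure_integral (normal_prob m s))// => A mA _.
  exact: (gaussY k k0).
have tailY B : exists2 p : R, p < 1 &
    forall k, (0 < k)%N -> (P (Y k @^-1` `]-oo, B]%classic) <= p%:E)%E.
  have fnp : normal_prob m s `]-oo, B]%classic \is a fin_num.
    by rewrite fin_num_measure.
  exists (fine (normal_prob m s `]-oo, B]%classic)); last first.
    by move=> k k0; rewrite lawY// fineK.
  rewrite -lte_fin fineK//.
  have BB : B < B + 1 by rewrite ltrDl.
  have pos := normal_prob_itv_gt0 m s0 BB.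
  have disj : `]-oo, B]%classic `&` `]B, (B + 1)%R]%classic = set0 :> set R.
    by apply/seteqP; split => y //= []; rewrite !in_itv/= => yB /andP[By _]; lra.
  have := @probability_le1 _ _ _ (normal_prob m s)
    (`]-oo, B]%classic `|` `]B, (B + 1)%R]%classic) (measurableU _ _ _ _).
  move=> /(_ (measurable_itv _) (measurable_itv _)).
  rewrite measureU//; apply: lt_le_trans.
  by rewrite lteDl.
have [q q01 decay] := @survival_exp_decay _ _ _ P Y r K (alpha 0%N) x (fine J)
  r0 r1 K0 (alpha_gt0 _) (fine_ge0 J0) indepY momY tailY.
apply: (limn_einf_gt0_exp_decay q01) => N.
have mE := measurable_sup_le_event Y alpha rho x N.
have fE : P (sup_le_event Y alpha rho N x) \is a fin_num.
  exact: fin_num_measure.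
rewrite -lte_fin -lee_fin fineK//; apply/andP; split.
  apply: sup_le_event_gt0 => // k B k0; rewrite lawY//.
  have BB : B - 1 < B by rewrite ltrBlDr ltrDl.
  apply: lt_le_trans (normal_prob_itv_gt0 m s0 BB) _.
  rewrite le_measure ?inE//.
  by move=> y /=; rewrite !in_itv/= => /andP[].
apply: le_trans (decay N); rewrite le_measure ?inE//.
- by apply: (@past_measurable _ _ _ _ Y N); exact: measurable_survival.
- exact: sup_le_event_sub_survival.
Qed.
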